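(* Let $T$ be a left-invertible bounded linear operator on a complex separable Hilbert space $\mathcal H$. Then the following statements hold: (i) $T(T^\infty(\mathcal H))=T^\infty(\mathcal H)$. (ii) For $\lambda\in\mathcal G(T)$, let $U_\lambda$ be a unitary operator on $\mathcal H$ which intertwines $T$ and $\lambda T$, i.e. $U_\lambda T=\lambda TU_\lambda$. Then $T^\infty(\mathcal H)$ is a reducing subspace of $U_\lambda$ for each $\lambda\in\mathcal G(T)$. Moreover, $U_\lambda|_{T^\infty(\mathcal H)}$ is unitary on $T^\infty(\mathcal H)$. (iii) $\mathcal G(T)\subseteq\mathcal G(T|_{T^\infty(\mathcal H)})$ and $\mathcal G(T)\subseteq\mathcal G(P_{T^\infty(\mathcal H)^\perp}T|_{T^\infty(\mathcal H)^\perp})$. (iv) Let $T'$ be the Cauchy dual of $T$. Then $\mathcal G(T)=\mathcal G(T')$. (v) Suppose that $T$ is analytic, let $T'$ be the Cauchy dual of $T$, and suppose that $\ker T^*=\operatorname{span}\{x\}$. Then $T$ is circular if and only if $\{T'^nx\}_{n\in\mathbb N}$ is a sequence of mutually orthogonal vectors.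
   Context: $\mathbb N$ denotes the set of non-negative integers and $\mathbb T=\{\lambda\in\mathbb C:|\lambda|=1\}$. A bounded linear operator $T$ on $\mathcal H$ is left-invertible if there is a bounded linear operator $L$ on $\mathcal H$ with $LT=I$; equivalently, $T^*T$ is invertible. For left-invertible $T$, the Cauchy dual is $T':=T(T^*T)^{-1}$. The hyper-range of $T$ is $T^\infty(\mathcal H):=\bigcap_{n\in\mathbb N}T^n(\mathcal H)$; it is a closed subspace when $T$ is left-invertible. $T$ is analytic if $T^\infty(\mathcal H)=\{0\}$. $P_{\mathcal M}$ denotes the orthogonal projection onto a closed subspace $\mathcal M$; $T|_{T^\infty(\mathcal H)}$ is regarded as an operator on $T^\infty(\mathcal H)$, and $P_{T^\infty(\mathcal H)^\perp}T|_{T^\infty(\mathcal H)^\perp}$ as an operator on $T^\infty(\mathcal H)^\perp$. For a bounded linear operator $A$ on a complex separable Hilbert space, $\mathcal G(A)$ denotes the set of all $\lambda\in\mathbb T$ such that $\lambda A$ is unitarily equivalent to $A$; in particular $\mathcal G(A)=\mathbb T$ if $A$ is the zero operator (including the operator on the zero space). $T$ is circular if for each $\lambda\in\mathbb T$ there exists a unitary $U_\lambda$ on $\mathcal H$ such that $U_\lambda T=\lambda TU_\lambda$. *)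

(* Defs.v *)
From HB Require Import structures.
From mathcomp Require Import all_boot all_order all_algebra.
From mathcomp Require Import sesquilinear complex.
From mathcomp Require Import all_classical all_reals topology normedtype.

Set Implicit Arguments.
Unset Strict Implicit.
Unset Printing Implicit Defensive.

Import Order.TTheory GRing.Theory Num.Theory.
Import numFieldNormedType.Exports.

Local Open Scope classical_set_scope.
Local Open Scope ring_scope.
Local Open Scope complex_scope.

(* [inner] is linear in its first argument and conjugate-linear in the second *)
HB.mixin Record Lmodule_isPreHilbert (R : realType) V & GRing.Lmodule R[i] V := {
  inner : {dot V for @Num.conj R[i]}
}.

#[short(type="preHilbertType")]
HB.structure Definition PreHilbert (R : realType) :=
  {V of GRing.Lmodule R[i] V & Lmodule_isPreHilbert R V}.

HB.mixin Record CompleteNormedModule_isHilbert (R : realType) V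
    & CompleteNormedModule R[i] V & PreHilbert R V := {
  sqr_norm_inner : forall x : V, `|x| ^+ 2 = (inner : V -> V -> R[i]) x x
}.

#[short(type="hilbertType")]
HB.structure Definition Hilbert (R : realType) :=
  {V of CompleteNormedModule R[i] V & PreHilbert R V
      & CompleteNormedModule_isHilbert R V}.

Definition separable (X : topologicalType) :=
  exists2 D : set X, countable D & dense D.

Section Subspace.
Context (R : realType) (V : preHilbertType R) (M : submodClosed V).

Definition subspace_type := {x : V | x \in M}.

HB.instance Definition _ := SubChoice.on subspace_type.
HB.instance Definition _ := [SubChoice_isSubLmodule of subspace_type by <:].

Definition sub_inner (u v : subspace_type) : R[i] := inner (val u) (val v).

Fact sub_inner_bilinear :
  bilinear_for *%R (@Num.conj R[i] \; *%R) sub_inner.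
Proof.
by split=> [u' a u v|u a v w]; rewrite /sub_inner linearP ?(linearPl, linearPr).
Qed.

HB.instance Definition _ :=
  bilinear_isBilinear.Build _ _ _ _ _ _ sub_inner sub_inner_bilinear.

Fact sub_inner_hermitian (u v : subspace_type) :
  sub_inner u v = (-1) ^+ false * Num.conj (sub_inner v u).
Proof. exact: hermC. Qed.

HB.instance Definition _ :=
  isHermitianSesquilinear.Build _ _ _ _ sub_inner sub_inner_hermitian.

Fact sub_inner_gt0 (u : subspace_type) : u != 0 -> 0 < sub_inner u u.
Proof. by move=> u0; apply: neq0_dnorm_gt0. Qed.

HB.instance Definition _ := isDotProduct.Build _ _ sub_inner sub_inner_gt0.
HB.instance Definition _ := Lmodule_isPreHilbert.Build R subspace_type sub_inner.

End Subspace.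

Section Unitary.
Context (R : realType) (V : preHilbertType R).
Implicit Types (A B U : V -> V).

(* stated without completeness so that it applies to V and to its subspaces *)
Definition unitary U :=
  [/\ linear U, isometry inner inner U & forall y, exists x, U x = y].

Definition intertwines U A B := forall x, U (A x) = B (U x).

Definition unitarily_equivalent A B :=
  exists2 U, unitary U & intertwines U A B.

Definition circle : set R[i] := [set l | `|l| = 1].

(* the set $\mathcal G(A)$ *)
Definition calG A : set R[i] :=
  [set l | circle l /\ unitarily_equivalent A (fun x => l *: A x)].

Definition circular A := forall l, circle l ->
  exists2 U, unitary U & intertwines U A (fun x => l *: A x).

End Unitary.

Section Stable.
Context (R : realType) (V : preHilbertType R).
Implicit Types (M : submodClosed V) (A : V -> V).

Definition stable M A := forall x, x \in M -> A x \in M.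

Definition restrict_op M A (stA : stable M A) (u : subspace_type M) :
    subspace_type M :=
  exist _ (A (val u)) (stA (val u) (valP u)).

Definition orth (M : {pred V}) : {pred V} :=
  mem [set x | forall y, y \in M -> inner x y = 0].

Fact orth_submod_closed (M : {pred V}) : submod_closed (orth M).
Proof.
split=> [|a x y]; first by apply/mem_set => z _; rewrite linear0l.
move=> /set_mem ox /set_mem oy; apply/mem_set => z zM.
by rewrite linearPl /= ox// oy// mulr0 addr0.
Qed.

HB.instance Definition _ (M : {pred V}) :=
  GRing.isSubmodClosed.Build _ _ (orth M) (orth_submod_closed M).

(* the orthogonal projection onto M; it exists when M is closed and V is a
   Hilbert space, and 0 is a junk value otherwise *)
Definition proj M (x : V) : subspace_type M :=
  xget 0 [set p | x - val p \in orth M].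

Definition compress_op M A (u : subspace_type M) : subspace_type M :=
  proj M (A (val u)).

Definition hyper_range A : {pred V} :=
  mem (\bigcap_(n in [set: nat]) range (iter n A)).

Fact hyper_range_submod_closed (T : {linear V -> V}) :
  submod_closed (hyper_range T).
Proof.
have lin n : linear (iter n T).
  by elim: n => [|n IHn] a x y //=; rewrite IHn linearP.
split=> [|a x y].
  apply/mem_set => n _; exists 0 => //.
  by elim: n => [|n IHn] //=; rewrite IHn linear0.
move=> /set_mem xT /set_mem yT; apply/mem_set => n _.
have [[x' _ <-] [y' _ <-]] := (xT n I, yT n I).
by exists (a *: x' + y'); rewrite ?lin.
Qed.

HB.instance Definition _ (T : {linear V -> V}) :=
  GRing.isSubmodClosed.Build _ _ (hyper_range T) (hyper_range_submod_closed T).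

Fact hyper_range_stable (T : {linear V -> V}) : stable (hyper_range T) T.
Proof.
move=> x /set_mem xT; apply/mem_set => n _.
by have [y _ <-] := xT n I; exists (T y); rewrite // -iterSr.
Qed.

Definition analytic A := [set` hyper_range A] = [set 0].

End Stable.

Section Operators.
Context (R : realType) (H : hilbertType R).
Implicit Types (T : {linear H -> H}) (A : H -> H).

Definition bounded_op A := exists c : R, forall x, `|A x| <= c%:C * `|x|.

Definition left_invertible A :=
  exists L : {linear H -> H}, bounded_op L /\ cancel A L.

(* for bounded linear A, Riesz' theorem gives existence (and uniqueness is
   clear), so that the default 0 is never used *)
Definition adjoint A (y : H) : H :=
  xget 0 [set z | forall x, inner (A x) y = inner x z].

(* T (T^* T)^-1; the operator T^* T is bijective when T is left-invertible *)
Definition cauchy_dual A : H -> H :=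
  A \o 'pinv_(fun=> 0) [set: H] (adjoint A \o A).

Definition reducing (M : submodClosed H) A :=
  [/\ closed [set` M], stable M A & stable (orth M) A].

End Operators.

(* Main.v *)
(** Write G = T^*T; it is bijective because T is bounded below (minimize
    |T h|^2 - 2 Re <h, w> to solve G z = w), and T' = T G^-1.  If
    U T = l T U with U unitary and |l| = 1, then U and U^-1 map each range
    T^n(H) into itself; moreover T^* U = l U T^*, so U commutes with G and
    U T' = l T' U.  Since T'^*T' = G^-1, one has T'' = T, and the argument
    applies to T' as well, which gives (iv).  In (v), U maps the line ker T^*
    to itself and so multiplies e_n = T'^n x by l^n c with |c| = 1; choosing l
    with l^(n-m) = -1 makes e_m and e_n orthogonal.  Conversely, L = T'^* is a
    left inverse of T with T^*(1 - T L) = 0, so a vector y orthogonal to every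
    e_n satisfies y = T^n L^n y for all n, and analyticity makes (e_n) total.
    The diagonal operator e_n |-> l^n e_n is then unitary and intertwines T'
    and l T', hence also T and l T. *)

Require Import Defs.
From HB Require Import structures.
From mathcomp Require Import all_boot all_order all_algebra.
From mathcomp Require Import sesquilinear complex.
From mathcomp Require Import all_classical all_reals topology normedtype.
From mathcomp Require Import ring lra.

Import Order.TTheory GRing.Theory Num.Theory.
Import numFieldNormedType.Exports.

Local Open Scope classical_set_scope.
Local Open Scope ring_scope.
Local Open Scope complex_scope.

Set Implicit Arguments.
Unset Strict Implicit.

(** * Unitaries, intertwining relations and projections in pre-Hilbert spaces *)

Section PreHilbert.
Context (R : realType) (V : preHilbertType R).
Implicit Types (x y z : V) (l : R[i]) (A U W : V -> V).

Lemma innerC x y : inner y x = Num.conj (inner x y).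
Proof. by rewrite hermC /= expr0 mul1r. Qed.

Lemma innerZl l x y : inner (l *: x) y = l * inner x y.
Proof. by rewrite linearZl_LR. Qed.

Lemma innerZr l x y : inner x (l *: y) = Num.conj l * inner x y.
Proof. by rewrite linearZr_LR. Qed.

Lemma innerDl x y z : inner (x + y) z = inner x z + inner y z.
Proof. exact: linearDl. Qed.

Lemma innerDr x y z : inner x (y + z) = inner x y + inner x z.
Proof. exact: linearDr. Qed.

Lemma inner_eq0 x : inner x x = 0 -> x = 0.
Proof. by move=> /eqP; rewrite dnorm_eq0 => /eqP. Qed.

Lemma inner_injr y z : (forall x, inner x y = inner x z) -> y = z.
Proof.
by move=> yz; apply/subr0_eq/inner_eq0; rewrite linearBr /= yz subrr.
Qed.

Lemma circle1 : circle (1 : R[i]).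
Proof. exact: normr1. Qed.

Lemma circle_conjM l : circle l -> l * Num.conj l = 1.
Proof. by rewrite -normCK => ->; rewrite expr1n. Qed.

Lemma circle_neq0 l : circle l -> l != 0.
Proof. by rewrite -normr_eq0 => ->; rewrite oner_neq0. Qed.

Lemma circle_conj l : circle l -> circle (Num.conj l).
Proof. by rewrite /circle /= norm_conjC. Qed.

Lemma linear_scalable U : linear U -> scalable U.
Proof. by move=> /GRing.scalable_linear. Qed.

Lemma unitaryV U : unitary U ->
  exists W, [/\ cancel U W, cancel W U & unitary W].
Proof.
move=> [linU isoU surjU].
have injU x y : U x = U y -> x = y.
  by move=> Uxy; apply: inner_injr => z; rewrite -isoU -[RHS]isoU Uxy.
have [W UW] := choice surjU.
have WU : cancel U W by move=> x; apply: injU; rewrite UW.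
exists W; split=> //; split=> [a x y|x y|y]; last by exists (U y).
- by apply: injU; rewrite linU !UW.
- by rewrite -isoU !UW.
Qed.

Lemma intertwinesV l A U W : l != 0 -> cancel U W -> cancel W U -> linear W ->
  intertwines U A (fun x => l *: A x) ->
  intertwines W A (fun x => l^-1 *: A x).
Proof.
move=> l0 UK WK linW UA x; rewrite -{1}[x]WK.
have -> : A (U (W x)) = l^-1 *: U (A (W x)).
  by rewrite UA scalerA mulVf// scale1r.
by rewrite (linear_scalable linW) UK.
Qed.

Lemma intertwines_iter l A U : scalable A ->
  intertwines U A (fun x => l *: A x) ->
  forall n, intertwines U (iter n A) (fun x => l ^+ n *: iter n A x).
Proof.
move=> ZA UA; elim=> [|n IHn] x; first by rewrite expr0 scale1r.
by rewrite /= UA IHn ZA scalerA -exprS.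
Qed.

(** The scalar is absorbed into the preimage: U T^n y = l^n T^n U y = T^n (l^n U y). *)
Lemma intertwines_hyper_range l (T : {linear V -> V}) U :
  intertwines U T (fun x => l *: T x) -> stable (hyper_range T) U.
Proof.
move=> UT x /set_mem xT; apply/mem_set => n _.
have [y _ <-] := xT n I; exists (l ^+ n *: U y) => //.
have ZT : scalable T by move=> a z; rewrite linearZ.
rewrite (intertwines_iter ZT UT); elim: n {xT} (l ^+ n) => //= n IHn a.
by rewrite IHn ZT.
Qed.

(** Since U W = 1 and U is isometric, <U x, y> = <x, W y>, and [W] keeps y inside [M]. *)
Lemma stable_orth (M : submodClosed V) U W : isometry inner inner U ->
  cancel W U -> stable M W -> stable (orth M) U.
Proof.
move=> isoU WK stW x /set_mem xM; apply/mem_set => y yM.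
by rewrite -[y]WK; apply: etrans (isoU _ _) (xM _ (stW _ yM)).
Qed.

Lemma unitary_restrict_op (M : submodClosed V) U W (stU : stable M U) :
  unitary U -> cancel W U -> stable M W -> unitary (restrict_op stU).
Proof.
move=> [linU isoU _] WK stW; split=> [a x y|x y|y].
- by apply: val_inj; rewrite /= linU.
- exact: isoU.
- exists (exist _ (W (val y)) (stW _ (valP y))).
  by apply: val_inj; rewrite /= WK.
Qed.

Lemma submodB (M : submodClosed V) x y : x \in M -> y \in M -> x - y \in M.
Proof. by move=> xM yM; rewrite -scaleN1r rpredD ?rpredZ. Qed.

(** The difference of two candidates lies both in [M] and in [orth M], hence vanishes. *)
Lemma proj_eq (M : submodClosed V) x (p : subspace_type M) :
  x - val p \in orth M -> Defs.proj M x = p.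
Proof.
move=> xp; apply: xget_unique => // q xq; apply: val_inj.
have pqM : val q - val p \in M by apply: submodB; exact: valP.
have pqO : val q - val p \in orth M.
  by have := submodB xp xq; rewrite opprB addrC subrKA.
by apply/subr0_eq/inner_eq0; move/set_mem: pqO; apply.
Qed.

Lemma proj_none (M : submodClosed V) x :
  (forall p : subspace_type M, x - val p \notin orth M) -> Defs.proj M x = 0.
Proof. by move=> xN; apply: xgetPN => p /=; exact/negP/xN. Qed.

(** Dividing by l turns a projection of l x into one of x, so either both exist or both sides are
    the junk value 0. *)
Lemma projZ (M : submodClosed V) l x : l != 0 ->
  Defs.proj M (l *: x) = l *: Defs.proj M x.
Proof.
move=> l0; have [[p xp]|xN] :=
  pselect (exists p : subspace_type M, x - val p \in orth M).
  by rewrite (proj_eq xp); apply: proj_eq; rewrite GRing.valZ -scalerBr rpredZ.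
rewrite (@proj_none _ x) ?scaler0 => [|p]; last first.
  by apply/negP => xp; apply: xN; exists p.
apply: proj_none => p; apply/negP => xp; apply: xN; exists (l^-1 *: p).
by rewrite -(scale1r x) -(mulVf l0) -scalerA GRing.valZ -scalerBr rpredZ.
Qed.

(* When x has no projection, neither has U x, and both sides are the junk
   value 0; hence the existence of projections is not needed. *)
Lemma proj_unitary (M : submodClosed V) U W (stU : stable M U) x :
  unitary U -> cancel U W -> cancel W U -> unitary W -> stable M W ->
  Defs.proj M (U x) = restrict_op stU (Defs.proj M x).
Proof.
move=> [linU isoU _] UK WK [linW isoW _] stW.
have subL U' u v : linear U' -> U' (u - v) = U' u - U' v.
  by move=> linU'; rewrite addrC -scaleN1r linU' scaleN1r addrC.
have oU := stable_orth isoU WK stW; have oW := stable_orth isoW UK stU.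
have [[p xp]|xN] :=
  pselect (exists p : subspace_type M, x - val p \in orth M).
  by rewrite (proj_eq xp); apply: proj_eq; rewrite /= -subL// oU.
have U0 : restrict_op stU 0 = 0.
  apply: val_inj; have : U (0 - 0) = 0 by rewrite subL// subrr.
  by rewrite subrr.
rewrite (@proj_none _ x) ?U0 => [|p]; last first.
  by apply/negP => xp; apply: xN; exists p.
apply: proj_none => p; apply/negP => xp; apply: xN.
exists (exist _ (W (val p)) (stW _ (valP p))).
by rewrite /= -[x]UK -subL// oW.
Qed.

End PreHilbert.

(** * Real parts of inner products and the Cauchy-Schwarz inequality *)

Section RealInner.
Context (R : realType) (V : preHilbertType R).
Implicit Types (x y z : V) (t : R).

Definition re_inner x y : R := complex.Re (inner x y).

Definition sqnorm x : R := re_inner x x.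

Lemma re_innerC x y : re_inner x y = re_inner y x.
Proof. by rewrite /re_inner innerC; case: (inner y x). Qed.

Lemma re_innerDl x y z : re_inner (x + y) z = re_inner x z + re_inner y z.
Proof. by rewrite /re_inner linearDl raddfD. Qed.

Lemma re_innerZl t x y : re_inner (t%:C *: x) y = t * re_inner x y.
Proof.
by rewrite /re_inner innerZl; case: (inner x y) => a b /=; rewrite mul0r subr0.
Qed.

Lemma re_innerBl x y z : re_inner (x - y) z = re_inner x z - re_inner y z.
Proof. by rewrite /re_inner linearBl raddfB. Qed.

Lemma re_innerDr x y z : re_inner x (y + z) = re_inner x y + re_inner x z.
Proof. by rewrite re_innerC re_innerDl !(re_innerC x). Qed.

Lemma re_innerZr t x y : re_inner x (t%:C *: y) = t * re_inner x y.
Proof. by rewrite re_innerC re_innerZl (re_innerC x). Qed.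

Lemma inner_sqnorm x : inner x x = (sqnorm x)%:C.
Proof.
by rewrite /sqnorm /re_inner RRe_real// ger0_real// dnorm_ge0.
Qed.

Lemma sqnorm_ge0 x : 0 <= sqnorm x.
Proof. by rewrite -lecR -inner_sqnorm dnorm_ge0. Qed.

Lemma sqnormN x : sqnorm (- x) = sqnorm x.
Proof. by rewrite /sqnorm /re_inner hnormN. Qed.

Lemma sqnormD x y : sqnorm (x + y) = sqnorm x + 2 * re_inner x y + sqnorm y.
Proof.
by rewrite /sqnorm re_innerDl !re_innerDr (re_innerC y x); ring.
Qed.

Lemma sqnormB x y : sqnorm (x - y) = sqnorm x - 2 * re_inner x y + sqnorm y.
Proof.
rewrite sqnormD sqnormN re_innerC /re_inner linearNl raddfN /= innerC.
by case: (inner x y) => a b /=; ring.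
Qed.

Lemma sqnormZ t x : sqnorm (t%:C *: x) = t ^+ 2 * sqnorm x.
Proof. by rewrite /sqnorm re_innerZl re_innerZr mulrA expr2. Qed.

Lemma discriminant_le0 (a b c : R) : 0 <= a ->
  (forall t, 0 <= a * t ^+ 2 + 2 * b * t + c) -> b ^+ 2 <= a * c.
Proof.
rewrite le_eqVlt => /predU1P[<-|a0] abc.
  have [->|b0] := eqVneq b 0; first by rewrite expr0n mul0r.
  (* For a = 0 the polynomial is affine of slope 2 b, and takes the value -1 at this t. *)
  have := abc (- (c + 1) / (2 * b)).
  have -> :
      0 * (- (c + 1) / (2 * b)) ^+ 2 + 2 * b * (- (c + 1) / (2 * b)) + c = -1.
    by field.
  by rewrite ler0N1.
(* For a > 0, evaluate at the vertex of the parabola. *)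
have := abc (- b / a).
have -> : a * (- b / a) ^+ 2 + 2 * b * (- b / a) + c = (a * c - b ^+ 2) / a.
  by field; rewrite gt_eqF.
by rewrite pmulr_lge0 ?invr_gt0// subr_ge0.
Qed.

Lemma re_inner_Cauchy_Schwarz x y :
  re_inner x y ^+ 2 <= sqnorm y * sqnorm x.
Proof.
apply: discriminant_le0 => [|t]; first exact: sqnorm_ge0.
have := sqnorm_ge0 (x + t%:C *: y).
by rewrite sqnormD sqnormZ re_innerZr; lra.
Qed.

(** Linearity over the complex numbers recovers imaginary parts: Re (f ('i x)) = - Im (f x). *)
Lemma re_inner_eq (f g : V -> R[i]) : scalar f -> scalar g ->
  (forall x, complex.Re (f x) = complex.Re (g x)) -> f =1 g.
Proof.
move=> linf ling fg x.
have fi : f ('i *: x) = 'i * f x by rewrite (GRing.scalable_linear linf).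
have gi : g ('i *: x) = 'i * g x by rewrite (GRing.scalable_linear ling).
have := fg ('i *: x); rewrite fi gi; have := fg x.
case: (f x) (g x) => [a b] [c d] /= -> .
by rewrite !mul0r !mul1r !add0r => /oppr_inj ->.
Qed.

End RealInner.

Lemma le0_of_small (R : realFieldType) (x M : R) : 0 <= M ->
  (forall e, 0 < e -> x <= e * M) -> x <= 0.
Proof.
move=> M0 xe; rewrite leNgt; apply/negP => x0.
have M1 : 0 < 2 * (M + 1) by lra.
(* The choice e = x / (2 (M + 1)) would give x <= x M / (2 (M + 1)) < x. *)
have d0 := divr_gt0 x0 M1; have := xe _ d0.
have := mulr_ge0 (ltW d0) M0.
have : x = x / (2 * (M + 1)) * (2 * (M + 1)) by rewrite divfK ?gt_eqF.
by set d := x / _ in d0 *; lra.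
Qed.

(** * Completeness and the minimization of a quadratic functional *)

Section Hilbert.
Context (R : realType) (H : hilbertType R).
Implicit Types (x y z : H) (u : nat -> H).

Definition cvg_sqnorm u z := forall e : R, 0 < e ->
  exists N, forall n, (N <= n)%N -> sqnorm (u n - z) < e.

Lemma norm_lt_sqnorm x (e : R) : 0 < e -> (`|x| < e%:C) = (sqnorm x < e ^+ 2).
Proof.
move=> e0; rewrite -ltcR rmorphXn /= -inner_sqnorm -sqr_norm_inner.
by rewrite ltr_pXn2r// nnegrE// ler0c ltW.
Qed.

Lemma sqnorm_complete u :
  (forall e : R, 0 < e -> exists N, forall m n, (N <= m)%N -> (N <= n)%N ->
     sqnorm (u m - u n) < e) ->
  exists z, cvg_sqnorm u z.
Proof.
move=> cu.
have : cauchy (u @ \oo).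
  apply: cauchy_exP => e e0.
  have eE : e = (complex.Re e)%:C by rewrite RRe_real// gtr0_real.
  move: e0; rewrite eE (ltcR 0) => e0.
  have [N uN] := cu _ (exprn_gt0 2 e0).
  exists (u N); exists N => // n /= Nn.
  by rewrite -ball_normE /ball_ /= norm_lt_sqnorm// uN//=.
move=> /cauchy_cvgP /cvg_ex[z uz]; exists z => e e0.
have s0 : 0 < Num.sqrt e by rewrite sqrtr_gt0.
have s0' : 0 < (Num.sqrt e)%:C by rewrite (ltcR 0).
move/cvgrPdist_lt : uz => /(_ _ s0')[N _ uN]; exists N => n Nn.
by rewrite -sqnormN opprB -[ltRHS]sqr_sqrtr ?(ltW e0)// -norm_lt_sqnorm// uN.
Qed.

Definition sqbounded (A : H -> H) :=
  exists2 c : R, 0 <= c & forall x, sqnorm (A x) <= c * sqnorm x.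

Lemma bounded_op_sqbounded (A : H -> H) : bounded_op A -> sqbounded A.
Proof.
move=> [c Ac]; exists (c ^+ 2) => [|x]; first exact: sqr_ge0.
rewrite -lecR rmorphM rmorphXn /= -!inner_sqnorm -!sqr_norm_inner -exprMn.
by rewrite ler_sqr ?nnegrE// ?(le_trans _ (Ac x)).
Qed.

(** Along the line u + t h the functional minus I is a nonnegative quadratic polynomial in t with
    constant term below e; its discriminant bounds the derivative at u. *)
Lemma quadratic_min_approx (A B : {linear H -> H}) (w u : H) (I e : R) :
  (forall h, I <= sqnorm (A h) - 2 * re_inner (B h) w) ->
  sqnorm (A u) - 2 * re_inner (B u) w < I + e ->
  forall h, (re_inner (A u) (A h) - re_inner (B h) w) ^+ 2 <= e * sqnorm (A h).
Proof.
move=> minI uI h; rewrite mulrC; apply: discriminant_le0 => [|t].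
  exact: sqnorm_ge0.
have := minI (u + t%:C *: h).
rewrite (linearD A) (linearD B) (linearZ_LR A) (linearZ_LR B) /=.
rewrite sqnormD sqnormZ re_innerZr re_innerDl re_innerZl.
by lra.
Qed.

(* The vector z minimizes the functional |A h|^2 - 2 Re <B h, w> of h. *)
Lemma lax_milgram (A B : {linear H -> H}) (w : H) :
  sqbounded A -> sqbounded B ->
  (exists2 k : R, 0 <= k & forall x, sqnorm x <= k * sqnorm (A x)) ->
  exists z, forall h, inner (B h) w = inner (A h) (A z).
Proof.
move=> [a a0 Aa] [b b0 Bb] [k k0 Ak].
pose q h := sqnorm (A h) - 2 * re_inner (B h) w.
pose K := b * k * sqnorm w.
have K0 : 0 <= K by rewrite /K !mulr_ge0 ?sqnorm_ge0.
have q_lb h : - K <= q h.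
  have := re_inner_Cauchy_Schwarz (B h) w.
  have : sqnorm w * sqnorm (B h) <= K * sqnorm (A h).
    rewrite /K (mulrC _ (sqnorm w)) -mulrA ler_wpM2l ?sqnorm_ge0//.
    by rewrite (le_trans (Bb h))// -mulrA ler_wpM2l.
  have := sqnorm_ge0 (A h); rewrite /q.
  set r := re_inner _ _; set t := sqnorm (A h) => t0 h1 h2.
  (* If q h < - K then 2 r > t + K >= 0, so 4 r^2 > (t + K)^2 >= 4 K t, against r^2 <= K t. *)
  rewrite leNgt; apply/negP => h3.
  have h4 : 0 < 2 * r - (t + K) by lra.
  have h5 : 0 < 2 * r + (t + K) by lra.
  have := mulr_gt0 h4 h5; have := sqr_ge0 (t - K).
  by lra.
have hasI : has_inf (range q).
  split; first by exists (q 0), 0.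
  by exists (- K) => _ [h _ <-].
set I := inf (range q).
have qI h : I <= q h by apply: ge_inf; [exact: hasI.2|exists h].
have /choice[u uI] n : exists x, q x < I + n.+1%:R^-1.
  have n0 : (0 : R) < n.+1%:R^-1 by rewrite invr_gt0 ltr0Sn.
  by have [_ [h _ <-] hI] := inf_adherent n0 hasI; exists h.
have dP n h := quadratic_min_approx qI (uI n) h.
have small (e : R) : 0 < e -> exists N, forall n, (N <= n)%N -> n.+1%:R^-1 < e.
  move=> e0; exists (Num.truncn e^-1) => n Nn.
  by rewrite invf_plt ?posrE// -truncn_le_nat.
have [e e0|z uz] := @sqnorm_complete u.
  have k1 : 0 < k + 1 by lra.
  (* The threshold f = e / (4 (k + 1)) is such that s <= 4 f yields |u m - u n|^2 <= k s <= 4 k f <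
     e. *)
  have [N Ns] := small _ (divr_gt0 e0 (mulr_gt0 (ltr0Sn R 3) k1)).
  exists N => m n Nm Nn.
  have := dP m (u m - u n); have := dP n (u m - u n).
  have := Ns _ Nm; have := Ns _ Nn.
  have : re_inner (A (u m)) (A (u m - u n)) - re_inner (A (u n)) (A (u m - u n))
         = sqnorm (A (u m - u n)).
    by rewrite -re_innerBl -linearB.
  have := Ak (u m - u n); have := sqnorm_ge0 (A (u m - u n)).
  set dm := re_inner (A (u m)) _; set dn := re_inner (A (u n)) _.
  set s := sqnorm (A _); set v := sqnorm (u m - u n); set r := re_inner (B _) _.
  set f := e / _; set im := m.+1%:R^-1; set i_n := n.+1%:R^-1.
  move=> s0 vs sE inf imf hn hm.
  have fE : f * (4 * (k + 1)) = e by rewrite divfK// gt_eqF// mulr_gt0.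
  have f0 : 0 < f by rewrite divr_gt0// mulr_gt0.
  (* As s = dm - dn, s^2 <= 2 (dm - r)^2 + 2 (dn - r)^2 <= 4 f s. *)
  have sf : s <= 4 * f.
    have sm : im * s <= f * s by rewrite ler_wpM2r// ltW.
    have sn : i_n * s <= f * s by rewrite ler_wpM2r// ltW.
    rewrite leNgt; apply/negP => fs.
    have s1 : 0 < s * (s - 4 * f) by rewrite mulr_gt0; lra.
    have : s ^+ 2 = 2 * (dm - r) ^+ 2 + 2 * (dn - r) ^+ 2
                    - (dm + dn - 2 * r) ^+ 2 by rewrite -sE; ring.
    by have := sqr_ge0 (dm + dn - 2 * r); lra.
  have ks : k * s <= k * (4 * f) by rewrite ler_wpM2l.
  by lra.
exists z.
have dz h : (re_inner (A h) (A z) - re_inner (B h) w) ^+ 2 <= 0.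
  (* The factor 2 (1 + a) |A h|^2 gathers two errors: |A (u n - z)|^2 <= a e from the convergence of
     u, and 1 / (n + 1) < e from [dP]. *)
  apply: (@le0_of_small _ _ (2 * (1 + a) * sqnorm (A h))) => [|e e0].
    by rewrite !mulr_ge0 ?sqnorm_ge0//; lra.
  have [N1 s1] := small _ e0; have [N2 s2] := uz _ e0.
  pose n := maxn N1 N2.
  have := s1 n (leq_maxl _ _); have := s2 n (leq_maxr _ _).
  have := dP n h; have := Aa (u n - z).
  have := re_inner_Cauchy_Schwarz (A (u n - z)) (A h).
  rewrite linearB /= re_innerBl (re_innerC (A z)).
  have := sqnorm_ge0 (A h).
  set s := sqnorm (A h); set v := sqnorm (u n - z); set r := re_inner (B h) w.
  set p := re_inner (A (u n)) _; set p' := re_inner (A h) _.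
  set t := sqnorm (A (u n) - A z); set i_n := n.+1%:R^-1.
  move=> s0 h1 h2 h3 h4 h5.
  have h6 : t <= a * e by rewrite (le_trans h2)// ler_wpM2l// ltW.
  have h7 : s * t <= s * (a * e) by rewrite ler_wpM2l.
  have h8 : i_n * s <= e * s by rewrite ler_wpM2r// ltW.
  have : (p' - r) ^+ 2 = 2 * (p - p') ^+ 2 + 2 * (p - r) ^+ 2
                         - (2 * p - p' - r) ^+ 2 by ring.
  by have := sqr_ge0 (2 * p - p' - r); lra.
apply: (@re_inner_eq _ _ (fun h => inner (B h) w) (fun h => inner (A h) (A z))).
- by move=> c x y; rewrite linearP linearPl.
- by move=> c x y; rewrite linearP linearPl.
- move=> h; have := dz h; rewrite exprn_even_le0//= subr_eq0 => /eqP;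
  exact: esym.
Qed.

End Hilbert.

(** * Adjoints, Cauchy duals and their intertwining relations *)

Section CauchyDual.
Context (R : realType) (H : hilbertType R).
Implicit Types (x y z : H) (l : R[i]) (A B S U W : H -> H).

Definition is_adjoint A B := forall x y, inner (A x) y = inner x (B y).

Lemma is_adjointC A B : is_adjoint A B -> is_adjoint B A.
Proof. by move=> AB x y; rewrite innerC -AB -innerC. Qed.

Lemma adjointE A B : is_adjoint A B -> adjoint A = B.
Proof.
move=> AB; apply/funext => y; apply: xget_unique => [x|z zP]; first exact: AB.
by apply: inner_injr => x; rewrite -zP AB.
Qed.

Lemma is_adjoint_linear A B : is_adjoint A B -> linear B.
Proof.
move=> AB a x y; apply: inner_injr => z.
by rewrite innerDr innerZr -!AB innerDr innerZr.
Qed.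

(** Riesz representation of x |-> <T x, y>, obtained from [lax_milgram] with the identity for [A]
    and [T] for [B]. *)
Lemma adjointP (T : {linear H -> H}) : bounded_op T -> is_adjoint T (adjoint T).
Proof.
move=> /bounded_op_sqbounded bT x y.
have idb : sqbounded (idfun : H -> H) by exists 1 => // z; rewrite mul1r.
have idk :
    exists2 k : R, 0 <= k & forall z : H, sqnorm z <= k * sqnorm (idfun z).
  by exists 1 => // z; rewrite mul1r.
have [z zP] := lax_milgram y idb bT idk.
suff : exists z, forall x, inner (T x) y = inner x z.
  by move=> /(xgetPex 0); apply.
by exists z.
Qed.

(* S is the inverse of A^* A, where B = A^*. *)
Definition gram_inverse A B S :=
  [/\ is_adjoint A B, cancel S (B \o A) & cancel (B \o A) S].

(** The bound on L makes T bounded below. With G = [adjoint T \o T], solving G z = w is then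
    [lax_milgram] with [T] for [A] and the identity for [B]; injectivity comes from |T (x - y)|^2 =
    <x - y, G (x - y)>. *)
Lemma left_invertible_gram_inverse (T : {linear H -> H}) :
  bounded_op T -> left_invertible T ->
  exists S, gram_inverse T (adjoint T) S.
Proof.
move=> bT [L [bL TL]].
have sT := bounded_op_sqbounded bT.
have below : exists2 k : R, 0 <= k & forall x, sqnorm x <= k * sqnorm (T x).
  have [k k0 kL] := bounded_op_sqbounded bL.
  by exists k => // x; rewrite -{1}[x]TL.
have idb : sqbounded (idfun : H -> H) by exists 1 => // z; rewrite mul1r.
have adjT := adjointP bT.
have surj w : exists z, adjoint T (T z) = w.
  have [z zP] := lax_milgram w sT idb below; exists z.
  by apply: inner_injr => x; rewrite -adjT -zP.
have inj x y : adjoint T (T x) = adjoint T (T y) -> x = y.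
  have linB := is_adjoint_linear adjT.
  move=> xy; apply: (can_inj TL); apply/subr0_eq/inner_eq0.
  have -> : T x - T y = T (x - y) by rewrite linearB.
  have -> : inner (T (x - y)) (T (x - y)) =
            inner (x - y) (adjoint T (- 1 *: T y + T x)).
    by rewrite adjT scaleN1r (addrC (- _)) -linearB.
  by rewrite linB xy scaleN1r addNr linear0r.
have [S ST] := choice surj.
by exists S; split=> // x; apply: inj; rewrite ST.
Qed.

Lemma cauchy_dualE A B S : gram_inverse A B S -> cauchy_dual A = A \o S.
Proof.
move=> [AB SG GS]; rewrite /cauchy_dual (adjointE AB); congr (_ \o _).
apply/funext => x; rewrite -{1}[x]SG pinvKV ?inE//.
by move=> y z _ _; exact: (can_inj GS).
Qed.

(** [S] is self-adjoint because [B \o A] is, so [A \o S] has adjoint [S \o B]; its Gram operator S B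
    A S reduces to S. *)
Lemma gram_inverse_dual A B S : gram_inverse A B S ->
  gram_inverse (A \o S) (S \o B) (B \o A).
Proof.
move=> [AB SG GS]; split=> [x y|x|x] /=; last 2 first.
- by have /= E := GS x; rewrite E.
- by have /= E := SG x; rewrite E.
have SS u v : inner (S u) v = inner u (S v).
  by rewrite -{1}[v]SG -{2}[u]SG /= -AB (is_adjointC AB).
by rewrite AB SS.
Qed.

Lemma cauchy_dualK A B S : gram_inverse A B S ->
  cauchy_dual (cauchy_dual A) = A.
Proof.
move=> G; have [_ _ GS] := G.
rewrite (cauchy_dualE G) (cauchy_dualE (gram_inverse_dual G)).
by apply/funext => x /=; have /= -> := GS x.
Qed.

(** As U is onto, the test vectors may be taken of the form U x; then l^-1 = conj l moves the scalar
    to the second argument. *)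
Lemma intertwines_adjoint l A B U : circle l -> unitary U -> is_adjoint A B ->
  intertwines U A (fun x => l *: A x) ->
  forall y, B (U y) = l *: U (B y).
Proof.
move=> l1 [linU isoU surjU] AB UA y; apply: inner_injr => z.
have [x <-] := surjU z.
have llU : U x = Num.conj l *: (l *: U x).
  by rewrite scalerA mulrC circle_conjM// scale1r.
have AU : A (U x) = l^-1 *: U (A x).
  by rewrite UA scalerA mulVf ?circle_neq0// scale1r.
have lV : l^-1 = Num.conj l.
  by rewrite -[LHS]mulr1 -(circle_conjM l1) mulKf ?circle_neq0.
rewrite -AB AU innerZl innerZr lV; congr (_ * _).
by rewrite [LHS]isoU [RHS]isoU; exact: AB.
Qed.

Lemma intertwines_cauchy_dual l A B S U : circle l -> scalable A ->
  unitary U -> gram_inverse A B S ->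
  intertwines U A (fun x => l *: A x) ->
  intertwines U (cauchy_dual A) (fun x => l *: cauchy_dual A x).
Proof.
move=> l1 ZA uU G UA x; rewrite (cauchy_dualE G) /=.
have [AB SG GS] := G; rewrite UA; congr (_ *: A _).
(* It remains to see that U commutes with S. After the injective [B \o A] is applied, the factor
   l^-1 from [A] cancels the factor l from [B]. *)
apply: (can_inj GS) => /=; have /= -> := SG (U x).
have -> : A (U (S x)) = l^-1 *: U (A (S x)).
  by rewrite UA scalerA mulVf ?circle_neq0// scale1r.
rewrite (linear_scalable (is_adjoint_linear AB)).
rewrite (intertwines_adjoint l1 uU AB UA) scalerA mulVf ?circle_neq0// scale1r.
by have /= -> := SG x.
Qed.

Lemma calG_cauchy_dual A B S : scalable A -> gram_inverse A B S ->
  calG A `<=` calG (cauchy_dual A).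
Proof.
move=> ZA G l [l1 [U uU UA]]; split=> //; exists U => //.
exact: (intertwines_cauchy_dual l1 ZA uU G).
Qed.

End CauchyDual.

(** * Diagonal unitaries along a total orthogonal sequence *)

Section Diagonal.
Context (R : realType) (H : hilbertType R).
Implicit Types (x y z w : H) (u v : nat -> H) (l : R[i]).

Lemma cvg_re_inner u v x y z w : cvg_sqnorm u x -> cvg_sqnorm v w ->
  (exists N, forall n, (N <= n)%N -> re_inner (u n) z = re_inner y (v n)) ->
  re_inner x z = re_inner y w.
Proof.
move=> ux vw [N0 uv].
have : (re_inner x z - re_inner y w) ^+ 2 <= 0.
  apply: (@le0_of_small _ _ (2 * (sqnorm z + sqnorm y))) => [|e e0].
    by rewrite mulr_ge0// addr_ge0// sqnorm_ge0.
  have [N1 uN] := ux _ e0; have [N2 vN] := vw _ e0.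
  pose n := maxn N0 (maxn N1 N2).
  have n0 : (N0 <= n)%N by rewrite leq_maxl.
  have n1 : (N1 <= n)%N by rewrite !leq_max leqnn orbT.
  have n2 : (N2 <= n)%N by rewrite !leq_max leqnn !orbT.
  have := re_inner_Cauchy_Schwarz (u n - x) z.
  have := re_inner_Cauchy_Schwarz (v n - w) y.
  rewrite !re_innerBl !(re_innerC _ y) (uv _ n0).
  have := uN _ n1; have := vN _ n2; have := sqnorm_ge0 z; have := sqnorm_ge0 y.
  set a := sqnorm y; set b := sqnorm z; set d := sqnorm (v n - w).
  set f := sqnorm (u n - x); set p := re_inner y (v n).
  set q := re_inner y w; set r := re_inner x z.
  move=> a0 b0 de fe h1 h2.
  have h3 : a * d <= a * e by rewrite ler_wpM2l// ltW.
  have h4 : b * f <= b * e by rewrite ler_wpM2l// ltW.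
  have : (r - q) ^+ 2 = 2 * (p - q) ^+ 2 + 2 * (p - r) ^+ 2
                         - (2 * p - q - r) ^+ 2 by ring.
  by have := sqr_ge0 (2 * p - q - r); lra.
by rewrite exprn_even_le0//= subr_eq0 => /eqP.
Qed.

Lemma cvg_inner u v x y z w : cvg_sqnorm u x -> cvg_sqnorm v w ->
  (exists N, forall n, (N <= n)%N -> inner (u n) z = inner y (v n)) ->
  inner x z = inner y w.
Proof.
move=> ux vw [N uv].
have reE : re_inner x z = re_inner y w.
  by apply: (cvg_re_inner ux vw); exists N => n /uv; rewrite /re_inner => ->.
(* The pairing with 'i z compares the imaginary parts. *)
have : re_inner x ('i *: z) = re_inner (Num.conj 'i *: y) w.
  apply: (cvg_re_inner ux vw); exists N => n /uv.
  by rewrite /re_inner innerZr innerZl => ->.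
move: reE; rewrite /re_inner innerZr innerZl.
case: (inner x z) (inner y w) => [a b] [c d] /= ->.
by rewrite !mul0r !sub0r !mulNr !opprK !mul1r => ->.
Qed.

Lemma cvg_sqnorm_cst x : cvg_sqnorm (fun=> x) x.
Proof.
move=> e e0; exists 0%N => n _.
by rewrite subrr /sqnorm /re_inner linear0r.
Qed.

Context (e : nat -> H).
Context (orth_e : forall m n, m != n -> inner (e m) (e n) = 0).
Context (total_e : forall x, (forall n, inner x (e n) = 0) -> x = 0).

(* If e i = 0 the coefficient is the junk value 0 / 0 = 0, as it should be. *)
Definition diag_sum l (N : nat) (x : H) : H :=
  \sum_(i < N) (l ^+ i * (inner x (e i) / inner (e i) (e i))) *: e i.

Lemma diag_sumS l N x : diag_sum l N.+1 x =
  diag_sum l N x + (l ^+ N * (inner x (e N) / inner (e N) (e N))) *: e N.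
Proof. by rewrite /diag_sum big_ord_recr. Qed.

Lemma inner_coefK x n : inner x (e n) / inner (e n) (e n) * inner (e n) (e n) =
  inner x (e n).
Proof.
have [/inner_eq0 ->|n0] := eqVneq (inner (e n) (e n)) 0; last by rewrite divfK.
by rewrite !linear0r mulr0.
Qed.

Lemma inner_diag_sum l N x n :
  inner (diag_sum l N x) (e n) =
  if (n < N)%N then l ^+ n * inner x (e n) else 0.
Proof.
elim: N => [|N IHN]; first by rewrite /diag_sum big_ord0 linear0l.
rewrite diag_sumS innerDl innerZl IHN ltnS [in RHS]leq_eqVlt.
have [->|nN] /= := eqVneq n N.
  by rewrite ltnn add0r -mulrA inner_coefK.
by rewrite (@orth_e N n) 1?eq_sym// mulr0 addr0.
Qed.

Lemma diag_sum_comp l l' N M x : (N <= M)%N ->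
  diag_sum l N (diag_sum l' M x) = diag_sum (l * l') N x.
Proof.
move=> NM; apply: eq_bigr => i _; congr (_ *: _).
by rewrite inner_diag_sum (leq_trans (ltn_ord i) NM) exprMn !mulrA.
Qed.

Lemma diag_sum_adjoint l N x y :
  inner (diag_sum l N x) y = inner x (diag_sum (Num.conj l) N y).
Proof.
elim: N => [|N IHN]; first by rewrite /diag_sum !big_ord0 linear0l linear0r.
rewrite !diag_sumS innerDl innerDr IHN innerZl innerZr; congr (_ + _).
rewrite !rmorphM /= fmorphV /= rmorphXn /= conjCK -!innerC; ring.
Qed.

(** Since l conj l = 1, both sides are the Bessel partial sum of |<x, e i>|^2 / |e i|^2 over i <
    M. *)
Lemma re_inner_diag_sum l M N x : circle l -> (M <= N)%N ->
  re_inner (diag_sum l M x) (diag_sum l N x) = re_inner (diag_sum 1 M x) x.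
Proof.
move=> l1 MN; rewrite re_innerC /re_inner -{2}[l]conjCK -diag_sum_adjoint.
by rewrite diag_sum_comp// mulrC circle_conjM.
Qed.

Lemma sqnorm_diag_sumB l M N x : circle l -> (M <= N)%N ->
  sqnorm (diag_sum l N x - diag_sum l M x) =
  re_inner (diag_sum 1 N x) x - re_inner (diag_sum 1 M x) x.
Proof.
move=> l1 MN; rewrite sqnormB (re_innerC (diag_sum l N x)) re_inner_diag_sum//.
by rewrite /sqnorm !re_inner_diag_sum//; ring.
Qed.

(** Bessel's inequality: [diag_sum 1 N] is the projection onto the span of the first N vectors, and
    |x - P x|^2 >= 0. *)
Lemma re_inner_diag_sum_le N x : re_inner (diag_sum 1 N x) x <= sqnorm x.
Proof.
have := sqnorm_ge0 (x - diag_sum 1 N x).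
rewrite sqnormB (re_innerC x) [X in _ + X]/sqnorm.
rewrite (re_inner_diag_sum _ (circle1 R))//.
by lra.
Qed.

Lemma diag_sum_cvg l x : circle l -> exists y, cvg_sqnorm (diag_sum l ^~ x) y.
Proof.
move=> l1; apply: sqnorm_complete => r r0.
pose p N := re_inner (diag_sum 1 N x) x.
have p_nd M N : (M <= N)%N -> p M <= p N.
  move=> MN; rewrite -subr_ge0.
  by rewrite -(sqnorm_diag_sumB x (circle1 R) MN) sqnorm_ge0.
have has_sup_p : has_sup (range p).
  split; first by exists (p 0), 0%N.
  by exists (sqnorm x) => _ [N _ <-]; exact: re_inner_diag_sum_le.
(* From N on, the monotone bounded sequence p varies by less than r, and its increments are the
   squared distances of the partial sums. *)
have [_ [N _ <-] pN] := sup_adherent r0 has_sup_p.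
exists N => m n.
have p_sup k : p k <= sup (range p).
  by apply: ub_le_sup; [exact: has_sup_p.2|exists k].
wlog nm : m n / (n <= m)%N => [th Nm Nn|Nm Nn].
  by have [/th|/ltnW/th] := leqP n m; [|rewrite -sqnormN opprB]; apply.
rewrite sqnorm_diag_sumB// -/(p m) -/(p n).
by have := p_sup m; have := p_nd _ _ Nn; lra.
Qed.

Lemma diagonal_ext x y : (forall n, inner x (e n) = inner y (e n)) -> x = y.
Proof.
by move=> xy; apply/subr0_eq/total_e => n; rewrite linearBl /= xy subrr.
Qed.

(** U and V are pointwise limits of the partial sums for l and conj l. Linearity, U V = 1 and V U =
    1 are checked on coefficients, which determine a vector by totality. *)
Lemma diagonal_unitary l : circle l -> exists U V : H -> H,
  [/\ unitary U, is_adjoint U V, forall n, U (e n) = l ^+ n *: e n &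
      forall n, V (e n) = Num.conj l ^+ n *: e n].
Proof.
move=> l1; have l1' := circle_conj l1.
have /choice[U UP] x := diag_sum_cvg x l1.
have /choice[V VP] x := diag_sum_cvg x l1'.
have coefE a (W : H -> H) : (forall x, cvg_sqnorm (diag_sum a ^~ x) (W x)) ->
    forall x n, inner (W x) (e n) = a ^+ n * inner x (e n).
  (* The n-th coefficient of the partial sums is constant from index n + 1 on, so a constant
     sequence stands on the other side. *)
  move=> WP x n; have cstP := @cvg_sqnorm_cst (Num.conj (a ^+ n) *: e n).
  rewrite (@cvg_inner _ _ _ x (e n) _ (WP x) cstP) ?innerZr ?conjCK//.
  by exists n.+1 => m nm; rewrite inner_diag_sum nm.
have UE := coefE _ _ UP; have VE := coefE _ _ VP.
have UV : is_adjoint U V.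
  move=> x y; apply: (cvg_inner (UP x) (VP y)).
  by exists 0%N => n _; exact: diag_sum_adjoint.
have VU x : V (U x) = x.
  apply: diagonal_ext => n.
  by rewrite VE UE mulrA -exprMn [X in X ^+ n]mulrC circle_conjM// expr1n mul1r.
have UV1 x : U (V x) = x.
  apply: diagonal_ext => n.
  by rewrite UE VE mulrA -exprMn circle_conjM// expr1n mul1r.
have diagE a (W : H -> H) :
    (forall x n, inner (W x) (e n) = a ^+ n * inner x (e n)) ->
    forall n, W (e n) = a ^+ n *: e n.
  move=> WE n; apply: diagonal_ext => k; rewrite WE innerZl.
  by have [->//|/eqP/negP/negP nk] := pselect (n = k); rewrite orth_e// !mulr0.
exists U, V; split=> //; last 2 first.
- exact: diagE UE.
- exact: diagE VE.
split=> [a x y|x y|y]; last by exists (V y).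
- by apply: diagonal_ext => n; rewrite UE !innerDl !innerZl !UE; ring.
- by have := UV x (U y); rewrite VU.
Qed.

End Diagonal.

(** * Circularity and orthogonality of the orbit of x under the Cauchy dual *)

Section Circular.
Context (R : realType) (H : hilbertType R).
Implicit Types (x y z : H) (l : R[i]) (A B S U : H -> H).

Lemma is_adjoint_iter A B n : is_adjoint A B ->
  is_adjoint (iter n A) (iter n B).
Proof. by move=> AB; elim: n => //= n IHn x y; rewrite AB IHn -iterSr. Qed.

Lemma circle_root_neg1 k : (0 < k)%N ->
  exists2 l : R[i], circle l & l ^+ k = -1.
Proof.
move=> k0; exists (k.-root (-1)); last exact: rootCK.
apply/eqP; rewrite -(@pexpr_eq1 _ _ k)// -normrX rootCK//.
by rewrite normrN1.
Qed.

Lemma circular_orthogonal A B S x : scalable A -> gram_inverse A B S ->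
  [set y | B y = 0] = [set c *: x | c in [set: R[i]]] -> circular A ->
  forall m n : nat, m != n ->
    inner (iter m (cauchy_dual A) x) (iter n (cauchy_dual A) x) = 0.
Proof.
move=> ZA G kerB circA m n.
have [AB SG GS] := G; have [A'B' _ _] := gram_inverse_dual G.
have ZA' : scalable (cauchy_dual A).
  rewrite (cauchy_dualE G).
  exact/linear_scalable/(is_adjoint_linear (is_adjointC A'B')).
wlog : m n / (m < n)%N => [th mn|mn _].
  have [mltn|nltm|mEn] := ltngtP m n.
  - exact: th.
  - by rewrite innerC th 1?eq_sym// conjC0.
  - by move: mn; rewrite mEn eqxx.
have nm0 : (0 < n - m)%N by rewrite subn_gt0.
have [l l1 lN] := circle_root_neg1 nm0.
have [U uU UA] := circA l l1; have [linU isoU _] := uU.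
have Bx : B x = 0.
  suff : [set c *: x | c in [set: R[i]]] x by rewrite -kerB.
  by exists 1; rewrite ?scale1r.
have [c _ Ux] : [set c *: x | c in [set: R[i]]] (U x).
  rewrite -kerB /= (intertwines_adjoint l1 uU AB UA) Bx.
  by rewrite -(scale0r 0) (linear_scalable linU) !scale0r scaler0.
have UA' := intertwines_iter ZA' (intertwines_cauchy_dual l1 ZA uU G UA).
have ZA'n k : scalable (iter k (cauchy_dual A)).
  by elim: k => // k IHk a y; rewrite /= IHk ZA'.
have Ue k :
    U (iter k (cauchy_dual A) x) = (l ^+ k * c) *: iter k (cauchy_dual A) x.
  by rewrite UA' -Ux ZA'n scalerA.
(* The relation U x = c x forces |c| = 1 only for nonzero x, so x = 0 is settled apart. *)
have [x0|x0] := eqVneq x 0.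
  have -> : iter m (cauchy_dual A) x = 0.
    by rewrite x0 -(scale0r 0) ZA'n !scale0r.
  exact: linear0l.
have cc : c * Num.conj c = 1.
  have : inner (U x) (U x) = inner x x by exact: isoU.
  rewrite -Ux innerZl innerZr mulrA -[RHS]mul1r => /mulIf; apply.
  by rewrite dnorm_eq0.
(* By isometry E = l^m c conj(l^n c) E, and conj(l)^(n - m) = -1 turns this into E = - E. *)
have : inner (U (iter m (cauchy_dual A) x)) (U (iter n (cauchy_dual A) x))
  = inner (iter m (cauchy_dual A) x) (iter n (cauchy_dual A) x) by exact: isoU.
rewrite !Ue innerZl innerZr !rmorphM !rmorphXn /=.
rewrite -{1}(subnKC (ltnW mn)) exprD.
rewrite -[Num.conj l ^+ (n - m)]rmorphXn lN rmorphN1.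
set E := inner _ _ => h.
have h2 : l ^+ m * Num.conj l ^+ m = 1 by rewrite -exprMn circle_conjM// expr1n.
have : (l ^+ m * Num.conj l ^+ m) * (c * Num.conj c) * E = - E.
  by rewrite -[in RHS]h; ring.
rewrite h2 cc !mul1r => /eqP; rewrite -addr_eq0 -mulr2n mulrn_eq0 /= => /eqP.
by [].
Qed.

Lemma analytic_total A B S x : gram_inverse A B S -> analytic A ->
  [set y | B y = 0] = [set c *: x | c in [set: R[i]]] ->
  forall y, (forall n, inner y (iter n (A \o S) x) = 0) -> y = 0.
Proof.
move=> G anA kerB y yx.
have [AB SG GS] := G; have [A'B' _ _] := gram_inverse_dual G.
have linB := is_adjoint_linear AB.
have Bx : B x = 0.
  suff : [set c *: x | c in [set: R[i]]] x by rewrite -kerB.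
  by exists 1; rewrite ?scale1r.
pose L := S \o B.
(* The vector z - A (L z) lies in ker B, so it is a multiple of x; it is also orthogonal to x, since
   z is and the range of A is orthogonal to ker B. *)
have ranA z : inner z x = 0 -> z = A (L z).
  move=> zx; apply/subr0_eq.
  have [c _ Pz] : [set c *: x | c in [set: R[i]]] (z - A (L z)).
    rewrite -kerB /= addrC -scaleN1r linB.
    by have /= -> := SG (B z); rewrite scaleN1r addNr.
  have Pzx : inner (z - A (L z)) x = 0.
    by rewrite linearBl /= zx AB Bx linear0r subrr.
  by apply: inner_eq0; rewrite -{2}Pz innerZr Pzx mulr0.
(* [L] is adjoint to [A \o S], so the hypothesis on y says that each L^n y is orthogonal to x. *)
have yL n : iter n L y = A (iter n.+1 L y).
  apply: ranA; apply/eqP; rewrite -conjC_eq0 -innerC; apply/eqP.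
  have := is_adjoint_iter n A'B' x y => <-.
  by rewrite innerC yx conjC0.
have yA n : y = iter n A (iter n L y).
  by elim: n => // n IHn; rewrite {1}IHn yL -iterSr.
suff : [set` hyper_range A] y by rewrite anA.
by apply/mem_set => n _; exists (iter n L y).
Qed.

Lemma orthogonal_circular A B S x : gram_inverse A B S -> analytic A ->
  [set y | B y = 0] = [set c *: x | c in [set: R[i]]] ->
  (forall m n : nat, m != n ->
    inner (iter m (cauchy_dual A) x) (iter n (cauchy_dual A) x) = 0) ->
  circular A.
Proof.
move=> G anA kerB; rewrite (cauchy_dualE G); set A' := A \o S => orth_e l l1.
have total_e := analytic_total G anA kerB.
have G' := gram_inverse_dual G; have [A'B' _ _] := G'.
have linA' := is_adjoint_linear (is_adjointC A'B').
have [U [V [uU UV Ue Ve]]] := diagonal_unitary orth_e total_e l1.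
have [linU _ _] := uU.
exists U => //; rewrite -(cauchy_dualK G) (cauchy_dualE G).
apply: (intertwines_cauchy_dual l1 (linear_scalable linA') uU G').
(* Once U and A' are moved to their adjoints, two vectors remain to be compared; their coefficients
   along [e n] agree because U A' e_n = l^(n+1) e_(n+1) = l A' U e_n. *)
move=> y; apply: inner_injr => z; rewrite innerC [RHS]innerC; congr Num.conj.
rewrite UV A'B' innerZl A'B' UV -[l in RHS]conjCK -innerZr.
congr (inner y _); apply: (diagonal_ext total_e) => n.
apply: (can_inj (@conjCK _)); rewrite -!innerC innerZr conjCK.
rewrite -A'B' -UV -UV -A'B' Ue (linear_scalable linA') innerZl.
rewrite -[(A \o S) _]/(iter n.+1 A' x) Ue innerZl mulrA -exprS.
by [].
Qed.

End Circular.

(** * The hyper-range under [T] and under its intertwiners *)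

Section HyperRange.
Context (R : realType) (H : hilbertType R).
Implicit Types (l : R[i]) (U W : H -> H).

Lemma bounded_op_continuous (T : {linear H -> H}) :
  bounded_op T -> continuous T.
Proof.
move=> [c Tc]; apply: bounded_linear_continuous; apply/linear_boundedP.
near=> r => x; apply: le_trans (Tc x) _; rewrite ler_wpM2r//.
near: r; apply: nbhs_pinfty_ge; rewrite complex_real//.
Unshelve. all: by end_near. Qed.

(** If x = T y and x = T (T^n z), injectivity gives y = T^n z; the same y thus serves for every
    n. *)
Lemma image_hyper_range (T : {linear H -> H}) : injective T ->
  T @` [set` hyper_range T] = [set` hyper_range T].
Proof.
move=> injT; apply/seteqP; split=> [_ [x xT <-]|x /set_mem xT].
  exact: hyper_range_stable.
have [y _ yx] := xT 1%N I; exists y => //.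
apply/mem_set => n _; have [z _ zx] := xT n.+1 I.
by exists z => //; apply: injT; rewrite [RHS]yx -zx.
Qed.

Lemma closed_hyper_range (T : {linear H -> H}) :
  bounded_op T -> left_invertible T -> closed [set` hyper_range T].
Proof.
move=> bT [L [bL TL]].
have TLn n x : iter n L (iter n T x) = x.
  by elim: n x => // n IHn x; rewrite iterSr [iter n.+1 T x]/= TL IHn.
have cont_iter (A : {linear H -> H}) n : bounded_op A -> continuous (iter n A).
  move=> /bounded_op_continuous cA; elim: n => [|n IHn] x /=.
    exact: cvg_id.
  by apply: continuous_comp; [exact: IHn|exact: cA].
have -> : [set` hyper_range T] = \bigcap_(n in [set: nat]) range (iter n T).
  by apply/seteqP; split=> x; [move/set_mem|move/mem_set].
apply: closed_bigI => n _.
(* The range of T^n is the set of fixed points of T^n L^n, that is, the zero set of a continuous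
   map. *)
have -> : range (iter n T) = (fun x => iter n T (iter n L x) - x) @^-1` [set 0].
  apply/seteqP; split=> [_ [x _ <-]|x /= /subr0_eq xE].
    by rewrite /= TLn subrr.
  by exists (iter n L x).
apply: preimage_closed; last first.
  exact/accessible_closed_set1/hausdorff_accessible/norm_hausdorff.
move=> x _.
apply: cvgB; last exact: cvg_id.
by apply: continuous_comp; exact: cont_iter.
Qed.

(** The inverse W intertwines T and l^-1 T, so [intertwines_hyper_range] applies to W too. Stability
    under both U and W is what makes the restrictions of U surjective. *)
Lemma intertwiner_inverse l (T : {linear H -> H}) U : circle l -> unitary U ->
  intertwines U T (fun x => l *: T x) ->
  exists W, [/\ cancel U W, cancel W U, unitary W, stable (hyper_range T) U &
                stable (hyper_range T) W].
Proof.
move=> l1 uU UT; have [W [UW WU uW]] := unitaryV uU.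
exists W; split=> //; first exact: intertwines_hyper_range UT.
have [linW _ _] := uW.
exact: intertwines_hyper_range (intertwinesV (circle_neq0 l1) UW WU linW UT).
Qed.

Lemma calG_restrict_op (T : {linear H -> H}) :
  calG T `<=` calG (restrict_op (@hyper_range_stable R H T)).
Proof.
move=> l [l1 [U uU UT]]; split=> //.
have [W [UW WU uW stU stW]] := intertwiner_inverse l1 uU UT.
exists (restrict_op stU); first exact: unitary_restrict_op WU stW.
by move=> x; apply: val_inj; rewrite /= UT.
Qed.

Lemma calG_compress_op (T : {linear H -> H}) :
  calG T `<=` calG (@compress_op R H (orth (hyper_range T)) T).
Proof.
move=> l [l1 [U uU UT]]; split=> //.
have [W [UW WU uW stU stW]] := intertwiner_inverse l1 uU UT.
have [_ isoU _] := uU; have [_ isoW _] := uW.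
have oU := stable_orth isoU WU stW; have oW := stable_orth isoW UW stU.
exists (restrict_op oU); first exact: unitary_restrict_op WU oW.
(* The nonzero l passes inside the projection, which commutes with U. *)
move=> x; rewrite /compress_op -projZ ?circle_neq0//= -UT.
by rewrite (proj_unitary oU _ uU UW WU uW oW).
Qed.

End HyperRange.

Theorem proposition2p4 (R : realType) (H : hilbertType R)
    (sepH : separable H) (T : {linear H -> H})
    (bT : bounded_op T) (linvT : left_invertible T) :
  (* (i) *)
  T @` [set` hyper_range T] = [set` hyper_range T] /\
  (* (ii) *)
  (forall (l : R[i]) (U : H -> H), l \in calG T ->
     unitary U -> intertwines U T (fun x => l *: T x) ->
     reducing (hyper_range T) U /\
     exists stU : stable (hyper_range T) U, unitary (restrict_op stU)) /\
  (* (iii) *)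
  (calG T `<=` calG (restrict_op (@hyper_range_stable R H T)) /\
   calG T `<=` calG (@compress_op R H (orth (hyper_range T)) T)) /\
  (* (iv) *)
  calG T = calG (cauchy_dual T) /\
  (* (v) *)
  (forall x : H, analytic T ->
     adjoint T @^-1` [set 0] = [set c *: x | c in [set: R[i]]] ->
     (circular T <->
      forall m n : nat, m != n ->
        inner (iter m (cauchy_dual T) x) (iter n (cauchy_dual T) x) = 0)).
Proof.
have ZT : scalable T by move=> a x; rewrite linearZ.
have [S G] := left_invertible_gram_inverse bT linvT.
split; first by have [L [_ TL]] := linvT; exact: image_hyper_range (can_inj TL).
split.
  move=> l U /set_mem[l1 _] uU UT; have [_ isoU _] := uU.
  have [W [_ WU _ stU stW]] := intertwiner_inverse l1 uU UT.
  split; last by exists stU; exact: unitary_restrict_op WU stW.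
  by split=> //; [exact: closed_hyper_range|exact: stable_orth WU stW].
split; first by split; [exact: calG_restrict_op|exact: calG_compress_op].
split.
  apply/seteqP; split; first exact: calG_cauchy_dual ZT G.
  (* The reverse inclusion is the direct one for T', whose Cauchy dual is T. *)
  rewrite -[X in _ `<=` calG X](cauchy_dualK G) (cauchy_dualE G).
  have G' := gram_inverse_dual G; have [A'B' _ _] := G'.
  have linA' := is_adjoint_linear (is_adjointC A'B').
  exact: calG_cauchy_dual (linear_scalable linA') G'.
move=> x anT kerT; split; first exact: circular_orthogonal ZT G kerT.
exact: orthogonal_circular G anT kerT.
Qed.
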